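(* Let $\mathcal{H}$ be a set of graphs such that no graph in $\mathcal{H}$ contains a dominating vertex and no graph in $\mathcal{H}$ contains a pair of non-adjacent vertices that are complete to the remainder of the graph. Then the class of $\mathcal{H}$-free atoms has bounded clique-width if and only if the class of $\mathcal{H}$-free graphs has bounded clique-width.
   Context: Graphs are finite, simple and undirected. A graph is $\mathcal{H}$-free if it contains no graph of $\mathcal{H}$ as an induced subgraph. A vertex $u$ of $G$ is dominating if it is adjacent to every vertex of $V(G)\setminus\{u\}$. A pair of (distinct) non-adjacent vertices $u,v$ is complete to the remainder of the graph if both $u$ and $v$ are adjacent to every vertex of $V(G)\setminus\{u,v\}$. A clique $K\subseteq V(G)$ (possibly empty) is a clique cut-set of $G$ if $G\setminus K$ is disconnected; an atom is a graph with no clique cut-set (so atoms are connected). The clique-width $\mathrm{cw}(G)$ is the minimum number of labels needed to construct $G$ using four operations: create a new graph consisting of a single vertex with label $i$; take the disjoint union of two labelled graphs; add an edge between every vertex with label $i$ and every vertex with label $j$ ($i\ne j$); relabel every vertex with label $i$ to have label $j$. A class of graphs has bounded clique-width if there is a constant $c$ with $\mathrm{cw}(G)\le c$ for every $G$ in the class; otherwise its clique-width is unbounded. *)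

(* Defs.v *)
From HB Require Import structures.
From mathcomp Require Import all_boot.
From mathcomp Require Import boolp.

Set Implicit Arguments.
Unset Strict Implicit.
Unset Printing Implicit Defensive.

(* The graph without vertices is allowed. *)
Record graph := Graph {
  vertex :> finType;
  adj : rel vertex;
  adj_sym : symmetric adj;
  adj_irr : irreflexive adj }.

Definition isomorphic (F G : graph) : Prop :=
  exists2 f : F -> G, bijective f & forall x y, adj (f x) (f y) = adj x y.

Section Induced.
Variables (G : graph) (A : {set G}).

Definition induced_adj : rel {x : G | x \in A} :=
  fun x y => adj (val x) (val y).

Lemma induced_adj_sym : symmetric induced_adj.
Proof. by move=> x y; apply: adj_sym. Qed.

Lemma induced_adj_irr : irreflexive induced_adj.
Proof. by move=> x; apply: adj_irr. Qed.

Definition induced : graph := Graph induced_adj_sym induced_adj_irr.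
End Induced.

Definition contains_induced (G F : graph) : Prop :=
  exists A : {set G}, isomorphic F (induced A).

Definition free (H : graph -> Prop) (G : graph) : Prop :=
  forall F, H F -> ~ contains_induced G F.

(* The only vertex of a one-vertex graph is dominating. *)
Definition dominating (G : graph) (u : G) : Prop :=
  forall v : G, v != u -> adj u v.

Definition nonadjacent_complete_pair (G : graph) (u v : G) : Prop :=
  [/\ u != v, ~~ adj u v
    & forall w : G, w != u -> w != v -> adj u w && adj v w].

(* A graph is disconnected when two of its vertices are not joined by a path,
   so the graph without vertices is connected, and hence no complete graph has
   a clique cut-set. *)
Definition connected (G : graph) : Prop :=
  forall x y : G, connect (@adj G) x y.

Definition clique (G : graph) (K : {set G}) : Prop :=
  {in K &, forall x y : G, x != y -> adj x y}.

Definition clique_cutset (G : graph) (K : {set G}) : Prop :=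
  clique K /\ ~ connected (induced (~: K)).

Definition atom (G : graph) : Prop :=
  forall K : {set G}, ~ clique_cutset K.

Record lgraph (k : nat) := LGraph {
  lgraph_graph :> graph;
  label : lgraph_graph -> 'I_k }.

Section Operations.
Variable k : nat.

Definition vtx_adj : rel unit := fun _ _ => false.

Lemma vtx_adj_sym : symmetric vtx_adj. Proof. by []. Qed.
Lemma vtx_adj_irr : irreflexive vtx_adj. Proof. by []. Qed.

Definition lg_vertex (i : 'I_k) : lgraph k :=
  @LGraph k (Graph vtx_adj_sym vtx_adj_irr) (fun=> i).

Section Union.
Variables G1 G2 : lgraph k.

Definition union_adj : rel (G1 + G2) := fun x y =>
  match x, y with
  | inl x1, inl y1 => adj x1 y1
  | inr x2, inr y2 => adj x2 y2
  | _, _ => false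
  end.

Lemma union_adj_sym : symmetric union_adj.
Proof. by move=> [x|x] [y|y] //=; apply: adj_sym. Qed.

Lemma union_adj_irr : irreflexive union_adj.
Proof. by move=> [x|x] /=; apply: adj_irr. Qed.

Definition lg_union : lgraph k :=
  @LGraph k (Graph union_adj_sym union_adj_irr)
    (fun x => match x with inl x1 => label x1 | inr x2 => label x2 end).
End Union.

Section Join.
Variables (i j : 'I_k) (neq_ij : i != j) (G : lgraph k).

Definition join_adj : rel G := fun x y =>
  [|| adj x y, (label x == i) && (label y == j)
    | (label x == j) && (label y == i)].

Lemma join_adj_sym : symmetric join_adj.
Proof.
move=> x y; rewrite /join_adj adj_sym; congr (_ || _).
by rewrite orbC; congr (_ || _); apply: andbC.
Qed.

Lemma join_adj_irr : irreflexive join_adj.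
Proof.
move=> x; rewrite /join_adj adj_irr /= [X in _ || X]andbC orbb.
by case: eqP => //= ->; apply: negbTE.
Qed.

Definition lg_join : lgraph k :=
  @LGraph k (Graph join_adj_sym join_adj_irr) (@label k G).
End Join.

Definition lg_relabel (i j : 'I_k) (G : lgraph k) : lgraph k :=
  @LGraph k G (fun x => if label x == i then j else label x).

Inductive cw_expr : Type :=
  | CwVertex of 'I_k
  | CwUnion of cw_expr & cw_expr
  | CwJoin (i j : 'I_k) of i != j & cw_expr
  | CwRelabel of 'I_k & 'I_k & cw_expr.

Fixpoint cw_eval (e : cw_expr) : lgraph k :=
  match e with
  | CwVertex i => lg_vertex i
  | CwUnion e1 e2 => lg_union (cw_eval e1) (cw_eval e2)
  | CwJoin i j neq_ij e1 => lg_join neq_ij (cw_eval e1)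
  | CwRelabel i j e1 => lg_relabel i j (cw_eval e1)
  end.
End Operations.

(* No expression builds the graph without vertices; by convention it needs no
   label. *)
Definition cw_constructible (G : graph) (k : nat) : Prop :=
  #|G| = 0 \/ exists e : cw_expr k, isomorphic (cw_eval e) G.

Lemma cw_edgeless (G : graph) (s : seq G) : s != [::] -> uniq s ->
  exists (e : cw_expr #|G|) (f : cw_eval e -> G),
    [/\ injective f, forall y, (y \in s) = [exists x, f x == y],
        forall x, label x = enum_rank (f x)
      & forall x y : cw_eval e, adj x y = false].
Proof.
elim: s => // a s IHs _ /= /andP[a_s us].
have [s0|s_n0] := eqVneq s [::].
  exists (CwVertex (enum_rank a)), (fun=> a); split => //=.
  - by move=> [] [].
  - move=> y; rewrite s0 inE eq_sym; apply/idP/existsP => [->|[]//].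
    by exists tt.
have [e [f [f_inj f_s f_lab f_adj]]] := IHs s_n0 us.
pose g (x : unit + cw_eval e) : G := if x is inr x2 then f x2 else a.
have f_a x : f x != a.
  by apply: contraNneq a_s => fx; rewrite f_s; apply/existsP; exists x; rewrite fx.
exists (CwUnion (CwVertex (enum_rank a)) e), g; split.
- move=> [[]|x] [[]|y] //= Exy.
  + by have := f_a y; rewrite -Exy eqxx.
  + by have := f_a x; rewrite Exy eqxx.
  + by rewrite (f_inj _ _ Exy).
- move=> y; rewrite inE f_s; apply/orP/existsP.
    move=> [/eqP->|/existsP[x fx]]; first by exists (inl tt) => /=.
    by exists (inr x).
  move=> [[[]|x] /= Ey]; first by left; rewrite eq_sym.
  by right; apply/existsP; exists x.
- by move=> [[]|x] /=.
- by move=> [[]|x] [[]|y] //=.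
Qed.

Lemma cw_edges (G : graph) (l : seq (G * G)) : 0 < #|G| ->
  exists (e : cw_expr #|G|) (f : cw_eval e -> G),
    [/\ bijective f, forall x, label x = enum_rank (f x)
      & forall x y : cw_eval e, adj x y =
          adj (f x) (f y) && (((f x, f y) \in l) || ((f y, f x) \in l))].
Proof.
move=> G_gt0; elim: l => [|[a b] l [e [f [f_bij f_lab f_adj]]]].
  have /cw_edgeless-/(_ (enum_uniq _)) : enum G != [::].
    by rewrite -size_eq0 -cardE -lt0n.
  move=> [e [f [f_inj f_s f_lab f_adj]]]; exists e, f; split=> // [|x y].
    have f_surj y : exists x, f x = y.
      have := f_s y; rewrite mem_enum => /esym/existsP[x /eqP fx].
      by exists x.
    have [g fg] := fin_all_exists f_surj.
    by exists g => x; last exact: fg; apply: f_inj; apply: fg.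
  by rewrite f_adj !in_nil andbF.
have adj_ab u v : adj a b != adj u v ->
    ((u == a) && (v == b) = false) * ((v == a) && (u == b) = false).
  by move=> neq; split; apply: contraNF neq => /andP[/eqP-> /eqP->];
    rewrite ?eqxx // adj_sym eqxx.
case ab: (adj a b) in adj_ab; last first.
  exists e, f; split => // x y; rewrite f_adj !inE !xpair_eqE.
  by case uv: (adj (f x) (f y)) => //=; rewrite !(adj_ab (f x) (f y)) ?uv.
have neq_ab : enum_rank a != enum_rank b.
  by rewrite (inj_eq enum_rank_inj); apply: contraTneq ab => ->; rewrite adj_irr.
exists (CwJoin neq_ab e), f; split => // x y.
rewrite /= /join_adj f_adj !f_lab !(inj_eq enum_rank_inj) !inE !xpair_eqE.
rewrite [(f x == b) && _]andbC.
case uv: (adj (f x) (f y)) => /=; last by rewrite !(adj_ab (f x) (f y)) ?uv.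
by rewrite [RHS]orbACA [RHS]orbC.
Qed.

Lemma cw_constructible_card (G : graph) : cw_constructible G #|G|.
Proof.
have [/eqP|G_gt0] := posnP #|G|; first by left; apply/eqP.
right; have [e [f [f_bij _ f_adj]]] := cw_edges (enum {: G * G}) G_gt0.
by exists e, f => // x y; rewrite f_adj !mem_enum andbT.
Qed.

Lemma cw_constructible_ex (G : graph) :
  exists k, `[< cw_constructible G k >].
Proof. by exists #|G|; apply/asboolP; apply: cw_constructible_card. Qed.

Definition cw (G : graph) : nat := ex_minn (cw_constructible_ex G).

Definition bounded_cw (C : graph -> Prop) : Prop :=
  exists c : nat, forall G, C G -> cw G <= c.

(* Main.v *)
Require Import Defs.
From mathcomp Require Import all_boot.
From mathcomp Require Import boolp.

(** Adding to a non-complete graph [G] two non-adjacent vertices that are both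
    complete to [G] yields an atom. A graph without dominating vertex and
    without non-adjacent pair complete to the remainder can only be induced in
    the extended graph if it is already induced in [G], so the extended graph
    is [H]-free whenever [G] is. Since clique-width is monotone under induced
    subgraphs, a bound for the extended graph is a bound for [G]; complete
    graphs are themselves atoms. *)

Set Implicit Arguments.
Unset Strict Implicit.
Unset Printing Implicit Defensive.

Definition embedding (F G : graph) (f : F -> G) : Prop :=
  injective f /\ forall x y, adj (f x) (f y) = adj x y.

(** The witnessing vertex set is the image of the map; afterwards maps can be composed without
    passing through subset types. *)
Lemma contains_inducedP (G F : graph) :
  contains_induced G F <-> exists f : F -> G, embedding f.
Proof.
split=> [[A [f /bij_inj f_inj f_adj]]|[f [f_inj f_adj]]].
  exists (fun x => val (f x)); split=> [x y /val_inj/f_inj //|x y].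
  by rewrite -f_adj.
pose A := [set f x | x in [set: F]].
have fA x : f x \in A by apply: imset_f.
exists A, (fun x => exist _ (f x) (fA x)) => [|x y]; last exact: f_adj.
have f_surj (y : induced A) : exists x, f x = val y.
  by case: y => y /= /imsetP[x _ ->]; exists x.
have [g fg] := fin_all_exists f_surj.
exists g => [x|y]; first by apply: f_inj; rewrite fg.
by apply: val_inj; rewrite /= fg.
Qed.

(** Prune from [e] the leaves that create vertices outside [A]. Joins and relabellings depend on
    labels only, so the induction must carry the preservation of labels. [A] is nonempty because
    every expression creates a vertex. *)
Lemma cw_eval_induced k (e : cw_expr k) (A : {set cw_eval e}) : A != set0 ->
  exists (e' : cw_expr k) (f : cw_eval e' -> cw_eval e),
    [/\ embedding f, forall x, label (f x) = label x
      & forall y, (y \in A) = [exists x, f x == y]].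
Proof.
elim: e A => [i|e1 IH1 e2 IH2|i j neq_ij e IH|i j e IH] A A_n0.
- exists (CwVertex i), id; split=> // [|y]; first by split.
  have /set0Pn[[] tA] := A_n0; case: y; rewrite tA.
  by apply/esym/existsP; exists tt.
(* A union one of whose sides misses [A] collapses to the pruned other side. *)
- have [A1_0|A1_n0] := eqVneq (inl @^-1: A) set0.
    have A1F (x : cw_eval e1) : (inl x \in A) = false.
      by have := in_set0 x; rewrite -A1_0 inE.
    have /IH2 [e' [f [[f_inj f_adj] f_lab f_A]]] : inr @^-1: A != set0.
      have /set0Pn[[x|x] xA] := A_n0; first by rewrite A1F in xA.
      by apply/set0Pn; exists x; rewrite inE.
    exists e', (fun x => inr (f x)); split=> //.
      by split=> [x y [] /f_inj|x y //=].
    move=> [y|y]; first by rewrite A1F; apply/esym/existsP => -[].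
    by have := f_A y; rewrite inE => ->.
  have [A2_0|A2_n0] := eqVneq (inr @^-1: A) set0.
    have A2F (x : cw_eval e2) : (inr x \in A) = false.
      by have := in_set0 x; rewrite -A2_0 inE.
    have [e' [f [[f_inj f_adj] f_lab f_A]]] := IH1 _ A1_n0.
    exists e', (fun x => inl (f x)); split=> //.
      by split=> [x y [] /f_inj|x y //=].
    move=> [y|y]; last by rewrite A2F; apply/esym/existsP => -[].
    by have := f_A y; rewrite inE => ->.
  have [e1' [f1 [[f1_inj f1_adj] f1_lab f1_A]]] := IH1 _ A1_n0.
  have [e2' [f2 [[f2_inj f2_adj] f2_lab f2_A]]] := IH2 _ A2_n0.
  exists (CwUnion e1' e2'),
    (fun x => match x with inl x1 => inl (f1 x1) | inr x2 => inr (f2 x2) end).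
  split; first split.
  + by move=> [x|x] [y|y] //= [] => [/f1_inj|/f2_inj] ->.
  + by move=> [x|x] [y|y] /=.
  + by move=> [x|x] /=.
  + move=> [y|y].
      have := f1_A y; rewrite inE => ->; apply/existsP/existsP => [[x fx]|].
        by exists (inl x).
      by move=> [[x|x] //= fx]; exists x.
    have := f2_A y; rewrite inE => ->; apply/existsP/existsP => [[x fx]|].
      by exists (inr x).
    by move=> [[x|x] //= fx]; exists x.
- have [e' [f [[f_inj f_adj] f_lab f_A]]] := IH A A_n0.
  exists (CwJoin neq_ij e'), f; split=> //; split=> // x y.
  by rewrite /= /join_adj f_adj !f_lab.
- have [e' [f [f_emb f_lab f_A]]] := IH A A_n0.
  by exists (CwRelabel i j e'), f; split=> // x; rewrite /= f_lab.
Qed.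

Lemma cw_constructible_embedding (F G : graph) (f : F -> G) k :
  embedding f -> cw_constructible G k -> cw_constructible F k.
Proof.
move=> [f_inj f_adj] [G0|[e [h [g hg gh] h_adj]]].
  by left; apply/eqP; rewrite -leqn0 -G0; apply: leq_card f_inj.
(* [A] is the copy of [F] inside [cw_eval e]. If it is empty, [F] has no vertices and the convention
   for such graphs applies. *)
pose A := [set g (f x) | x in [set: F]].
have [A0|/cw_eval_induced[e' [p [[p_inj p_adj] _ p_A]]]] := eqVneq A set0.
  left; apply: eq_card0 => x; apply/negP => _.
  by have := in_set0 (g (f x)); rewrite -A0 imset_f.
right; exists e'.
have p_f (x : cw_eval e') : exists y, h (p x) = f y.
  have /imsetP[y _ ->] : p x \in A by rewrite p_A; apply/existsP; exists x.
  by exists y; rewrite gh.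
have f_p (y : F) : exists x, h (p x) = f y.
  have : g (f y) \in A by apply: imset_f.
  by rewrite p_A => /existsP[x /eqP px]; exists x; rewrite px gh.
have [q pq] := fin_all_exists p_f; have [r rf] := fin_all_exists f_p.
exists q => [|x y]; last by rewrite -f_adj -!pq h_adj p_adj.
exists r => [x|y]; last by apply: f_inj; rewrite -pq rf.
by apply/p_inj/(can_inj hg); rewrite rf pq.
Qed.

Lemma cw_embedding (F G : graph) (f : F -> G) : embedding f -> cw F <= cw G.
Proof.
move=> f_emb; rewrite /cw; case: ex_minnP => m _ m_min.
case: ex_minnP => n /asboolP Gn _; apply: m_min; apply/asboolP.
exact: (cw_constructible_embedding f_emb Gn).
Qed.

Lemma connected_center (G : graph) (c : G) :
  (forall x, connect (@adj G) c x) -> connected G.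
Proof.
move=> cG x y; apply: connect_trans (cG y).
by rewrite (sym_connect_sym (@adj_sym G)).
Qed.

Lemma complete_atom (G : graph) : clique [set: G] -> atom G.
Proof.
move=> G_cl K [_]; apply=> x y; have [->|xy] := eqVneq x y; first exact: connect0.
by apply/connect1/G_cl; rewrite ?inE.
Qed.

Section Suspension.
Variable G : graph.

(** The join of [G] with the edgeless graph on [bool], whose two elements are the added vertices. *)
Definition suspension_adj : rel (G + bool) := fun x y =>
  match x, y with
  | inl x1, inl y1 => adj x1 y1
  | inr _, inr _ => false
  | _, _ => true
  end.

Lemma suspension_adj_sym : symmetric suspension_adj.
Proof. by move=> [x|x] [y|y] //=; apply: adj_sym. Qed.

Lemma suspension_adj_irr : irreflexive suspension_adj.
Proof. by move=> [x|x] //=; apply: adj_irr. Qed.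

Definition suspension : graph := Graph suspension_adj_sym suspension_adj_irr.

Lemma suspension_embedding : embedding (inl : G -> suspension).
Proof. by split=> // x y [->]. Qed.

Lemma suspension_atom : ~ clique [set: G] -> atom suspension.
Proof.
move=> G_ncl K [K_cl]; apply.
(* The added vertices are non-adjacent, so a clique misses one of them; it will be the center from
   which every remaining vertex is reached. *)
have [b bK] : exists b : bool, inr b \notin K.
  have [tK|] := boolP (inr true \in K); last by exists true.
  exists false; apply/negP => fK.
  by have := K_cl _ _ tK fK isT.
have b_nK : inr b \in ~: K by rewrite inE.
pose vtx x (x_nK : x \in ~: K) : induced (~: K) := exist _ x x_nK.
apply: (connected_center (c := vtx _ b_nK)).
move=> [[x|b'] x_nK]; first exact: connect1.
have [b'b|_] := eqVneq b' b.
  by subst b'; rewrite (bool_irrelevance x_nK b_nK) connect0.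
(* The other added vertex is reached through a remaining vertex [z] of [G]; if there were none, the
   clique [K] would contain all of [G]. *)
have [z zK] : exists z, inl z \notin K.
  apply: contrapT => K_all; apply: G_ncl => x y _ _ xy.
  have inK w : inl w \in K by apply: contrapT => /negP wK; apply: K_all; exists w.
  exact: K_cl (inK x) (inK y) xy.
have z_nK : inl z \in ~: K by rewrite inE.
by apply: (@connect_trans _ _ (vtx _ z_nK)); apply: connect1.
Qed.

(** If [f] hits both added vertices, their preimages form a pair complete to the remainder of [F];
    if it hits just one, the preimage is dominating. Hence [f] lands in [G]. *)
Lemma suspension_embedding_inv (F : graph) (f : F -> suspension) :
  ~ (exists u : F, dominating u) ->
  ~ (exists u v : F, nonadjacent_complete_pair u v) ->
  embedding f -> exists g : F -> G, embedding g.
Proof.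
move=> F_dom F_pair [f_inj f_adj].
suff f_inl x : exists y, f x = inl y.
  have [g fg] := fin_all_exists f_inl; exists g; split=> [x y gxy|x y].
    by apply: f_inj; rewrite !fg gxy.
  by rewrite -f_adj !fg.
case fx: (f x) => [y|b]; first by exists y.
have inl_adj w b' z : f z = inr b' -> (forall c, f w != inr c) -> adj z w.
  move=> fz fw; rewrite -f_adj fz; case fw': (f w) => [//|c].
  by have := fw c; rewrite fw' eqxx.
have [[z fz]|no_z] := pselect (exists z, f z = inr (~~ b)).
  (* By injectivity of [f], the added vertices [b] and [~~ b] are used up by [x] and [z]. *)
  have other w : w != x -> w != z -> forall c, f w != inr c.
    move=> wx wz c; rewrite -(inj_eq f_inj) fx in wx.
    rewrite -(inj_eq f_inj) fz in wz.
    by case: b c wx wz {fx fz} => -[] wx wz.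
  case: F_pair; exists x, z; split.
  - by apply: contra_eq_neq fz => <-; rewrite fx; case: (b).
  - by rewrite -f_adj fx fz.
  - move=> w wx wz.
    by rewrite (inl_adj _ _ _ fx (other _ wx wz)) (inl_adj _ _ _ fz (other _ wx wz)).
case: F_dom; exists x => w wx; apply: (inl_adj _ _ _ fx) => c.
rewrite -(inj_eq f_inj) fx in wx; apply/eqP => fw.
have [cb|cb] := eqVneq c b; first by rewrite fw cb eqxx in wx.
by apply: no_z; exists w; rewrite fw; case: (b) (c) cb => -[].
Qed.

End Suspension.

Lemma suspension_free (H : graph -> Prop) (G : graph) :
  (forall F : graph, H F -> ~ (exists u : F, dominating u)) ->
  (forall F : graph, H F -> ~ (exists u v : F, nonadjacent_complete_pair u v)) ->
  free H G -> free H (suspension G).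
Proof.
move=> H_dom H_pair G_free F HF /contains_inducedP[f f_emb].
apply: (G_free F HF); apply/contains_inducedP.
exact: suspension_embedding_inv (H_dom F HF) (H_pair F HF) f_emb.
Qed.

Theorem lemma14 (H : graph -> Prop)
    (H_dominating : forall F : graph, H F -> ~ (exists u : F, dominating u))
    (H_pair : forall F : graph, H F ->
       ~ (exists u v : F, nonadjacent_complete_pair u v)) :
  bounded_cw (fun G => free H G /\ atom G) <-> bounded_cw (free H).
Proof.
split=> -[c c_bound]; exists c => G; last by case=> G_free _; apply: c_bound.
(* Complete graphs are treated apart: for them [G] itself is a clique cut-set of the suspension,
   separating the two added vertices. *)
move=> G_free; have [G_cl|G_ncl] := pselect (clique [set: G]).
  by apply: c_bound; split=> //; apply: complete_atom.
apply: leq_trans (cw_embedding (suspension_embedding G)) _.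
by apply: c_bound; split; [apply: suspension_free | apply: suspension_atom].
Qed.
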